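(* Let $G$ be an ample Hausdorff étale groupoid, let $K$ be a field, and let $c:G\to H$ be a continuous cocycle into a discrete group $H$ with identity $e$. Assume that: (a) $c^{-1}(e)$ is strongly effective; (b) $G$ satisfies Property (FIC), i.e. every nonempty invariant subset $W\subseteq G^{(0)}$ with $|G|_W|<\infty$ is clopen in $G^{(0)}$; (c) $A_K(G)$ is infinite-dimensional over $K$. Then $A_K(G)$ is graded just infinite (with respect to the $H$-grading induced by $c$) if and only if $A_K(G)$ is graded simple.
   Context: An ample Hausdorff groupoid is a locally compact Hausdorff étale topological groupoid $G$ (range map $r$, source map $s$, unit space $G^{(0)}$) having a basis of compact open bisections, where a bisection is a set on which $r$ and $s$ are injective. The Steinberg algebra is $A_K(G)=\mathrm{span}_K\{1_U: U\subseteq G\text{ a compact open bisection}\}$ with convolution product, determined by $1_U*1_V=1_{UV}$. A continuous cocycle (groupoid homomorphism) $c:G\to H$ induces the $H$-grading with components $A_K(G)_h=\mathrm{span}_K\{1_U: U\subseteq c^{-1}(h)\text{ a compact open bisection}\}$. A set $W\subseteq G^{(0)}$ is invariant if $r(s^{-1}(W))=W$, and then $G|_W:=s^{-1}(W)\cap r^{-1}(W)$. A groupoid $G$ is effective if the interior of $\mathrm{Iso}(G)=\{g\in G:r(g)=s(g)\}$ equals $G^{(0)}$; it is strongly effective if $G|_C$ is effective for every closed invariant $C\subseteq G^{(0)}$. (For $c^{-1}(e)$, invariance is with respect to the groupoid $c^{-1}(e)$.) An ideal $I$ of an $H$-graded algebra $A=\bigoplus_h A_h$ is graded if $I=\bigoplus_h(A_h\cap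 I)$. A graded $K$-algebra $A$ is graded just infinite if $\dim_K A=\infty$ and $\dim_K A/J<\infty$ for every nonzero graded ideal $J\subseteq A$; it is graded simple if its only graded ideals are $0$ and $A$. *)

(* Defs.v *)
From HB Require Import structures.
From mathcomp Require Import all_boot all_order all_algebra.
From mathcomp Require Import all_classical all_reals.
From mathcomp Require Import topology numfun.

Set Implicit Arguments.
Unset Strict Implicit.
Unset Printing Implicit Defensive.

Import GRing.Theory.

Local Open Scope classical_set_scope.
Local Open Scope ring_scope.

Section LinearAlgebra.
Variables (K : fieldType) (E : lmodType K).

Definition lspan (X : set E) : set E :=
  [set x | exists (n : nat) (a : 'I_n -> K) (v : 'I_n -> E),
     (forall i, X (v i)) /\ x = \sum_(i < n) a i *: v i].

Definition subspace_closed (V : set E) : Prop :=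
  V 0 /\ forall (a : K) (x y : E), V x -> V y -> V (a *: x + y).

Definition finite_dim (V : set E) : Prop :=
  exists2 X : set E, finite_set X & V = lspan X.

(* The quotient V / W, for subspaces W `<=` V of E, is spanned by the classes
   of finitely many elements of V. *)
Definition finite_dim_quotient (V W : set E) : Prop :=
  exists X : set E, [/\ finite_set X, X `<=` V &
    forall x, V x -> exists2 y, lspan X y & W (x - y)].

Definition internal_direct_sum (I : choiceType) (V : set E) (W : I -> set E) :
    Prop :=
  (forall i, W i `<=` V) /\
  forall x, V x -> exists! w : I -> E,
    [/\ forall i, W i (w i), finite_set [set i | w i <> 0] &
        x = \sum_(i \in [set: I]) w i].

End LinearAlgebra.

(* The algebra is a subspace A of E, with product the restriction to A of mul
   (which need not be bilinear or associative outside A), and homogeneous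
   components Ah h. It need not have a unit. *)

Section GradedAlgebra.
Variables (K : fieldType) (E : lmodType K) (mul : E -> E -> E).
Variables (A : set E) (H : choiceType) (Ah : H -> set E).

Definition is_ideal (J : set E) : Prop :=
  [/\ J `<=` A, subspace_closed J &
      forall a x, A a -> J x -> J (mul a x) /\ J (mul x a)].

Definition graded_ideal (J : set E) : Prop :=
  is_ideal J /\ internal_direct_sum J (fun h => Ah h `&` J).

Definition graded_just_infinite : Prop :=
  ~ finite_dim A /\
  forall J, graded_ideal J -> J <> [set 0] -> finite_dim_quotient A J.

Definition graded_simple : Prop :=
  forall J, graded_ideal J -> J = [set 0] \/ J = A.

End GradedAlgebra.

(* A groupoid is given by its set of arrows; a unit is identified with its
   identity arrow. The product gmul g h is meaningful only when gs g = gr h,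
   and is unspecified otherwise. *)

HB.mixin Record isGroupoid G := {
  gr : G -> G;
  gs : G -> G;
  gmul : G -> G -> G;
  ginv : G -> G;
  gr_gs : forall g, gr (gs g) = gs g;
  gs_gr : forall g, gs (gr g) = gr g;
  gr_gmul : forall g h, gs g = gr h -> gr (gmul g h) = gr g;
  gs_gmul : forall g h, gs g = gr h -> gs (gmul g h) = gs h;
  gmulA : forall g h k, gs g = gr h -> gs h = gr k ->
    gmul g (gmul h k) = gmul (gmul g h) k;
  gmul_gr : forall g, gmul (gr g) g = g;
  gmul_gs : forall g, gmul g (gs g) = g;
  gr_ginv : forall g, gr (ginv g) = gs g;
  gs_ginv : forall g, gs (ginv g) = gr g;
  gmulV : forall g, gmul g (ginv g) = gr g;
  gmulVg : forall g, gmul (ginv g) g = gs g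
}.

#[short(type="groupoidType")]
HB.structure Definition Groupoid := {G of isGroupoid G & Choice G}.

HB.mixin Record isTopologicalGroupoid G of Groupoid G & Topological G := {
  gmul_continuous : {within [set p : G * G | gs p.1 = gr p.2],
                      continuous (fun p : G * G => gmul p.1 p.2)};
  ginv_continuous : continuous (@ginv G)
}.

#[short(type="topologicalGroupoidType")]
HB.structure Definition TopologicalGroupoid :=
  {G of Groupoid G & Topological G & isTopologicalGroupoid G}.

(* f is a local homeomorphism from X to B, where B has the topology induced
   from Y: it restricts to a homeomorphism from some open neighbourhood U of
   each point onto a relatively open subset of B. *)
Definition local_homeomorphism (X Y : topologicalType) (B : set Y)
    (f : X -> Y) : Prop :=
  (forall x, B (f x)) /\
  forall x, exists (U : set X) (O : set Y) (g : Y -> X),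
    [/\ open U, U x, open O & f @` U = O `&` B] /\
    [/\ {within U, continuous f}, {within f @` U, continuous g} &
        forall y, U y -> g (f y) = y].

Section Groupoids.
Variable G : topologicalGroupoidType.

Definition gunit : set G := [set u | gr u = u].

Definition setgmul (U V : set G) : set G :=
  [set x | exists g h, [/\ U g, V h, gs g = gr h & x = gmul g h]].

Definition etale : Prop :=
  local_homeomorphism gunit (@gr G) /\ local_homeomorphism gunit (@gs G).

Definition bisection (U : set G) : Prop :=
  {in U &, injective (@gr G)} /\ {in U &, injective (@gs G)}.

Definition compact_open_bisection (U : set G) : Prop :=
  [/\ compact U, open U & bisection U].

Definition ample_hausdorff : Prop :=
  [/\ locally_compact [set: G], hausdorff_space G, etale &
      basis compact_open_bisection].

(* In the next definitions, S is a subgroupoid of G, with the topology induced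
   from G (interiors and closed sets are those of subspaces); the whole
   groupoid is S = [set: G]. *)

Definition invariant (S W : set G) : Prop :=
  W `<=` S `&` gunit /\ @gr G @` (S `&` @gs G @^-1` W) = W.

Definition reduction (S W : set G) : set G :=
  S `&` (@gs G @^-1` W `&` @gr G @^-1` W).

Definition isotropy (S : set G) : set G := S `&` [set g | gr g = gs g].

Definition effective (S : set G) : Prop :=
  interior (isotropy S : set (subspace S)) = S `&` gunit.

Definition strongly_effective (S : set G) : Prop :=
  forall C : set G, invariant S C ->
    closed (C : set (subspace (S `&` gunit))) ->
    effective (reduction S C).

Definition FIC : Prop :=
  forall W : set G, W !=set0 -> invariant [set: G] W ->
    finite_set (reduction [set: G] W) -> clopen (W : set (subspace gunit)).

Definition continuous_cocycle (H : groupType) (c : G -> H) : Prop :=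
  (forall g h : G, gs g = gr h -> c (gmul g h) = (c g * c h)%g) /\
  continuous (c : G -> discrete_topology H).

Section SteinbergAlgebra.
Variable K : fieldType.

Definition steinberg : set (G -> K^o) :=
  lspan [set f | exists2 U, compact_open_bisection U & f = \1_U].

(* If f and g are in the Steinberg algebra, only finitely many terms of this
   sum are nonzero (the value of \sum_(_ \in _) _ would be 0 otherwise). *)
Definition convolution (f g : G -> K^o) : G -> K^o :=
  fun x => \sum_(p \in [set p : G * G | gs p.1 = gr p.2 /\ gmul p.1 p.2 = x])
             f p.1 * g p.2.

Definition steinberg_component (H : groupType) (c : G -> H) (h : H) :
    set (G -> K^o) :=
  lspan [set f | exists2 U,
    compact_open_bisection U /\ U `<=` c @^-1` [set h] & f = \1_U].

Lemma convolution_indic (U V : set G) :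
  bisection U -> bisection V ->
  convolution \1_U \1_V = \1_(setgmul U V).
Proof.
move=> [rU sU] [rV sV]; apply/funext => x; rewrite /convolution [RHS]indicE.
case: (pselect (setgmul U V x)) => [UVx|nUVx].
  rewrite mem_set//; case: UVx => a [b [Ua Vb sarb xab]].
  rewrite -(fsbig_widen [set (a, b)]) ?fsbig_set1 /= ?indicE ?mem_set ?mulr1//.
    by move=> _ -> /=; rewrite xab.
  move=> [a' b'] [/= [sarb' xab'] neq]; rewrite !indicE.
  case: (pselect (U a')) => [Ua'|nUa']; last by rewrite memNset // mul0r.
  case: (pselect (V b')) => [Vb'|nVb']; last by rewrite [b' \in V]memNset // mulr0.
  case: neq; congr (_, _).
    by apply: rU; rewrite ?inE// -(gr_gmul _ _ sarb') xab' xab gr_gmul.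
  by apply: sV; rewrite ?inE// -(gs_gmul _ _ sarb') xab' xab gs_gmul.
rewrite memNset// fsbig1// => -[a b] /= [sarb xab]; rewrite !indicE.
case: (pselect (U a)) => [Ua|nUa]; last by rewrite memNset // mul0r.
case: (pselect (V b)) => [Vb|nVb]; last by rewrite [b \in V]memNset // mulr0.
by case: nUVx; exists a, b.
Qed.

End SteinbergAlgebra.
End Groupoids.

Arguments steinberg G K : clear implicits.
Arguments convolution {G} K f g.
Arguments steinberg_component {G} K {H} c h.

(* Main.v *)
Require Import Defs.
From HB Require Import structures.
From mathcomp Require Import all_boot all_order all_algebra.
From mathcomp Require Import finmap.
From mathcomp Require Import all_classical all_reals.
From mathcomp Require Import topology numfun.

(** One direction is immediate: if the only graded ideals are 0 and A = A_K(G),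
    then a nonzero graded ideal is A and has zero-dimensional quotient.

    Conversely let J be a nonzero graded ideal of finite codimension, let D be
    the set of sources of the compact open bisections U with 1_U in J, and let
    W be the complement of D in the unit space. The set W is closed and
    invariant, and the ideal J is controlled by W in two ways.

    - Every function of J vanishes on the reduction of G to W
      ([graded_ideal_vanish]). Otherwise some homogeneous f in J is nonzero at
      an arrow g over W; convolving it with the indicator of a small bisection
      around the inverse of g gives an element f' of J of identity degree,
      nonzero at a unit of W. Strong effectiveness of the kernel of c yields a
      compact open set V of units, meeting W, such that 1_V * f' * 1_V is a
      nonzero multiple of 1_V ([steinberg_effective_cutdown]). Hence 1_V is in
      J, and the points of V belong to D, although V meets W.

    - If W is empty then J = A ([ideal_sources_full]), because each compact
      open bisection is a finite union of bisections with indicator in J.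

    So it is enough to show that W is empty. Evaluation on the reduction of G
    to W factors through A / J, and indicators of small bisections separate
    finitely many arrows, so this reduction is finite
    ([finite_set_of_finite_dim_quotient]). If W were nonempty, (FIC) would make
    it open, and the functions supported on the finite open set of arrows over
    W would form a nonzero graded ideal, of finite dimension
    ([finite_support_ideal]). This ideal has finite codimension by assumption,
    so A would be finite-dimensional ([steinberg_finite_dim]).

    The compact open bisections multiplied along the way come with an indicator
    in J. The indicator of the product is then in J, hence in A, and this makes
    the product itself compact and open ([cob_of_steinberg_indic]). *)

Set Implicit Arguments.
Unset Strict Implicit.
Unset Printing Implicit Defensive.

Import GRing.Theory.

Local Open Scope classical_set_scope.
Local Open Scope ring_scope.

(** * Spans and finite codimension *)

Section Span.
Variables (K : fieldType) (E : lmodType K).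
Implicit Types (X V : set E).

Lemma subspaceD V x y : subspace_closed V -> V x -> V y -> V (x + y).
Proof. by move=> [_ cl] Vx Vy; rewrite -[x]scale1r; exact: cl. Qed.

Lemma subspaceZ V a x : subspace_closed V -> V x -> V (a *: x).
Proof. by move=> [V0 cl] Vx; rewrite -[_ *: _]addr0; exact: cl. Qed.

Lemma subspaceB V x y : subspace_closed V -> V x -> V y -> V (x - y).
Proof.
move=> sV Vx Vy; apply: subspaceD => //.
by rewrite -scaleN1r; exact: subspaceZ.
Qed.

Lemma subspace_sum V (I : Type) (r : seq I) (P : pred I) (F : I -> E) :
  subspace_closed V -> (forall i, P i -> V (F i)) ->
  V (\sum_(i <- r | P i) F i).
Proof.
move=> sV VF; apply: big_ind => //; first by case: sV.
by move=> x y; exact: subspaceD.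
Qed.

Lemma sub_lspan X : X `<=` lspan X.
Proof.
move=> x Xx; exists 1%N, (fun=> 1), (fun=> x); split => //.
by rewrite big_ord1 scale1r.
Qed.

Lemma lspan_subspace X : subspace_closed (lspan X).
Proof.
split.
  by exists 0%N, (fun=> 0), (fun=> 0); split; [case|rewrite big_ord0].
move=> k _ _ [n [a [v [Xv ->]]]] [m [b [w [Xw ->]]]].
exists (n + m)%N,
  (fun i : 'I_(n + m) =>
     match fintype.split i with inl j => k * a j | inr j => b j end),
  (fun i : 'I_(n + m) =>
     match fintype.split i with inl j => v j | inr j => w j end).
split; first by move=> i; case: (fintype.split i).
rewrite big_split_ord scaler_sumr; congr (_ + _); apply: eq_bigr => i _.
  by rewrite (unsplitK (inl i)) scalerA.
by rewrite (unsplitK (inr i)).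
Qed.

Lemma lspan_min X V : subspace_closed V -> X `<=` V -> lspan X `<=` V.
Proof.
move=> sV XV _ [n [a [v [Xv ->]]]]; apply: subspace_sum => // i _.
by apply: subspaceZ => //; exact: XV.
Qed.

Lemma lspanS X Y : X `<=` Y -> lspan X `<=` lspan Y.
Proof.
move=> XY; apply: lspan_min; first exact: lspan_subspace.
exact: subset_trans XY (@sub_lspan Y).
Qed.

Lemma lspan_seqP (s : seq E) x : lspan [set` s] x ->
  exists b : 'I_(size s) -> K, x = \sum_i b i *: s`_i.
Proof.
pose V := [set x | exists b : 'I_(size s) -> K, x = \sum_i b i *: s`_i].
apply: (@lspan_min _ V).
  split; first by exists (fun=> 0); rewrite big1 // => i _; rewrite scale0r.
  move=> k _ _ [b ->] [d ->]; exists (fun i => k * b i + d i).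
  rewrite scaler_sumr -big_split; apply: eq_bigr => i _.
  by rewrite scalerDl scalerA.
move=> y /= ys; have /[dup] lt_ys : (index y s < size s)%N by rewrite index_mem.
move=> lt; exists (fun i => (i == Ordinal lt_ys)%:R).
rewrite (bigD1 (Ordinal lt_ys)) //= eqxx scale1r nth_index // big1 ?addr0 //.
by move=> i /negPf ->; rewrite scale0r.
Qed.

End Span.

(** If A / J is spanned by n classes and R had n + 1 points, then functions of
    A separating these points, corrected modulo J, would factor an identity
    matrix of size n + 1 through a space of dimension n. *)
Lemma finite_set_of_finite_dim_quotient (T : choiceType) (K : fieldType)
    (A J : set (T -> K^o)) (R : set T) :
  finite_dim_quotient A J ->
  (forall f t, J f -> R t -> f t = 0) ->
  (forall (F : set T) t, finite_set F -> ~ F t ->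
    exists2 f, A f & f t = 1 /\ forall u, F u -> f u = 0) ->
  finite_set R.
Proof.
move=> [X [/finite_seqP [s ->] _ XA]] J0 sep.
apply: contrapT => Rinf; have [x0 _] := infinite_setN0 Rinf.
have [F FR sF] := infinite_set_fset (size s).+1 Rinf.
pose t (i : 'I_(size s).+1) : T := nth x0 F i.
have ltF (i : 'I_(size s).+1) : (i < #|` F|)%N by exact: leq_trans sF.
have t_inj : injective t.
  move=> i j /eqP; rewrite nth_uniq ?fset_uniq ?ltF // => /eqP.
  exact: val_inj.
have Rt i : R (t i) by apply: FR; rewrite /= mem_nth ?ltF.
have /choice [B HB] (i : 'I_(size s).+1) : exists b : 'I_(size s) -> K,
    forall j, \sum_k b k * s`_k (t j) = (i == j)%:R.
  have [||f Af [fi fj]] := sep (t @` [set j | j != i]) (t i).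
  - exact/finite_image/finite_finset.
  - by move=> [j /= /negP ji /t_inj /eqP].
  have [y Xy Jfy] := XA _ Af; have [b yE] := lspan_seqP Xy; exists b => j.
  have -> : \sum_k b k * s`_k (t j) = y (t j).
    by rewrite yE fct_sumE; apply: eq_bigr => k _.
  have /eqP := J0 _ _ Jfy (Rt j).
  rewrite -[X in X == _]/(f (t j) - y (t j)) subr_eq0 => /eqP <-.
  have [<- //|ij] := eqVneq i j.
  by apply: fj; exists j => //=; rewrite eq_sym.
pose M : 'M[K]_((size s).+1, size s) := \matrix_(i, k) B i k.
pose N : 'M[K]_(size s, (size s).+1) := \matrix_(k, j) s`_k (t j).
have MN : M *m N = 1%:M.
  apply/matrixP => i j; rewrite !mxE -HB.
  by apply: eq_bigr => k _; rewrite !mxE.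
by have := mulmx_max_rank M N; rewrite MN mxrank1 ltnn.
Qed.

(** * Cancellation and units in groupoids *)

Section GroupoidAlgebra.
Variable G : groupoidType.
Implicit Types g h u : G.

Lemma gmulI g h k : gs g = gr h -> gs g = gr k -> gmul g h = gmul g k -> h = k.
Proof.
move=> gh gk e; have /(congr1 (gmul (ginv g))) := e.
by rewrite !gmulA ?gs_ginv // !gmulVg gh gmul_gr -gh gk gmul_gr.
Qed.

Lemma gmulIg g h k : gs h = gr g -> gs k = gr g -> gmul h g = gmul k g -> h = k.
Proof.
move=> gh gk e; have /(congr1 (@gmul G ^~ (ginv g))) := e.
by rewrite -!gmulA ?gr_ginv // !gmulV -{1}gh gmul_gs -gk gmul_gs.
Qed.

Lemma gs_gunit u : gr u = u -> gs u = u.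
Proof. by move=> uu; rewrite -uu gs_gr uu. Qed.

Lemma gr_gunit_gs u : gs u = u -> gr u = u.
Proof. by move=> uu; rewrite -uu gr_gs uu. Qed.

End GroupoidAlgebra.

(** * Compact open bisections *)

Section Topology.
Variable G : topologicalGroupoidType.
Hypothesis ampleG : ample_hausdorff G.
Implicit Types (U V W : set G).

Let hausG : hausdorff_space G. Proof. by case: ampleG. Qed.

Lemma local_homeomorphism_continuous (X Y : topologicalType) (B : set Y)
  (f : X -> Y) : local_homeomorphism B f -> continuous f.
Proof.
move=> [_ lh] x; have [U [O [g [[oU Ux _ _] [cf _ _]]]]] := lh x.
by move: cf; rewrite continuous_open_subspace // => /(_ x (mem_set Ux)).
Qed.

Lemma local_homeomorphism_open (X Y : topologicalType) (B : set Y)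
    (f : X -> Y) (V : set X) :
  local_homeomorphism B f -> open B -> open V -> open (f @` V).
Proof.
move=> [_ lh] oB oV; rewrite openE => _ [x Vx <-].
have [U [O [g [[oU Ux oO fU] [_ cg gf]]]]] := lh x.
have ofU : open (f @` U) by rewrite fU; exact: openI.
move: cg; rewrite continuous_open_subspace // => cg.
have gcont : {for f x, continuous g}.
  by apply: cg; apply/mem_set; exists x.
have : nbhs (f x) (f @` U `&` g @^-1` V).
  apply: filterI; first by apply: open_nbhs_nbhs; split => //; exists x.
  by apply: gcont; rewrite gf //; exact: open_nbhs_nbhs.
apply: filterS => _ [[y Uy <-]]; rewrite /= gf // => Vy.
by exists y.
Qed.

Lemma gr_continuous : continuous (@gr G).
Proof.
by case: ampleG => _ _ [lr _] _; exact: local_homeomorphism_continuous lr.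
Qed.

Lemma gs_continuous : continuous (@gs G).
Proof.
by case: ampleG => _ _ [_ ls] _; exact: local_homeomorphism_continuous ls.
Qed.

(** Near a unit u the range map is injective, and it identifies each nearby x
    with gr x, so that x is a unit. *)
Lemma open_gunit : open (@gunit G).
Proof.
case: ampleG => _ _ [[lr0 lr] _] _; rewrite openE => u uu.
have [U [O [g [[oU Uu _ _] [_ _ grK]]]]] := lr u.
have : nbhs u (U `&` @gr G @^-1` U).
  apply: filterI; first exact: open_nbhs_nbhs.
  apply: gr_continuous; apply: open_nbhs_nbhs; split => //.
  by rewrite uu.
apply: filterS => x [Ux /= Urx]; have /= rrx := lr0 x.
by rewrite /gunit /= -[LHS]grK // rrx grK.
Qed.

Lemma gs_open U : open U -> open (@gs G @` U).
Proof.
case: ampleG => _ _ [_ ls] _; apply: local_homeomorphism_open ls _.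
exact: open_gunit.
Qed.

Lemma hausdorff_separation (x y : G) : x <> y ->
  exists A B, [/\ open A, open B, A x, B y & forall z, A z -> B z -> False].
Proof.
move/eqP; move: hausG; rewrite open_hausdorff => /[apply] -[[A B] /=].
move=> [/set_mem Ax /set_mem By] [oA oB AB0]; exists A, B; split=> // z Az Bz.
have AB := eqP AB0.
by have : (A `&` B) z by []; rewrite AB.
Qed.

Lemma closed_gunit : closed (@gunit G).
Proof.
rewrite -openC openE => u /= uu.
have [A [B [oA oB Au Bu AB]]] := hausdorff_separation uu.
have : nbhs u (@gr G @^-1` A `&` B).
  apply: filterI; last exact: open_nbhs_nbhs.
  by apply: gr_continuous; exact: open_nbhs_nbhs.
apply: filterS => x [/= Ax Bx] xx.
by apply: (AB x) => //; rewrite -xx.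
Qed.

Lemma cob_nbhs x (N : set G) : nbhs x N ->
  exists B, [/\ compact_open_bisection B, B x & B `<=` N].
Proof.
case: ampleG => _ _ _ [_ /(_ x)] bas /bas [B [cB Bx] BN].
by exists B.
Qed.

Lemma cob_closed U : compact_open_bisection U -> closed U.
Proof. by case=> cU _ _; exact: compact_closed. Qed.

Lemma bisection_sub U V : bisection U -> V `<=` U -> bisection V.
Proof.
move=> [rU sU] VU; split=> x y; rewrite !inE => Vx Vy.
  by apply: rU; rewrite inE; exact: VU.
by apply: sU; rewrite inE; exact: VU.
Qed.

Lemma bisection_gunit U : U `<=` @gunit G -> bisection U.
Proof.
move=> U1; split=> x y; rewrite !inE => /U1 xx /U1 yy.
  by rewrite xx yy.
by rewrite !gs_gunit.
Qed.

Lemma cobI U V : compact_open_bisection U -> open V -> closed V ->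
  compact_open_bisection (U `&` V).
Proof.
move=> [cU oU bU] oV cV; split.
- exact: compact_closedI.
- exact: openI.
- by apply: bisection_sub bU _; exact: subIsetl.
Qed.

Lemma cobD U V : compact_open_bisection U -> compact_open_bisection V ->
  compact_open_bisection (U `\` V).
Proof.
move=> cU cV; rewrite setDE; apply: cobI => //.
  by rewrite openC; exact: cob_closed.
by rewrite closedC; case: cV.
Qed.

Lemma cobU U V W : compact_open_bisection U -> compact_open_bisection V ->
  bisection W -> U `|` V `<=` W -> compact_open_bisection (U `|` V).
Proof.
move=> [cU oU _] [cV oV _] bW UVW; split.
- exact: compactU.
- exact: openU.
- exact: bisection_sub bW _.
Qed.

Lemma cob0 : compact_open_bisection (@set0 G).
Proof.
by split; [exact: compact0|exact: open0|apply: bisection_gunit => x].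
Qed.

Lemma gs_sub_gunit U : @gs G @` U `<=` @gunit G.
Proof. by move=> _ [x _ <-]; rewrite /gunit /= gr_gs. Qed.

Lemma cob_gs U :
  compact_open_bisection U -> compact_open_bisection (@gs G @` U).
Proof.
move=> [cU oU bU]; split.
- apply: continuous_compact cU; apply: continuous_subspaceT.
  exact: gs_continuous.
- exact: gs_open.
- exact/bisection_gunit/gs_sub_gunit.
Qed.

(** A hereditary property of sets that is stable under binary unions and holds
    locally on a compact set holds for the whole set: otherwise the sets whose
    relative complement has the property would form a proper filter, without
    cluster point in the compact set. *)
Lemma compact_ind (T : topologicalType) (A : set T) (P : set (set T)) :
  P set0 -> (forall S S', S `<=` S' -> P S' -> P S) ->
  (forall S S', P S -> P S' -> P (S `|` S')) ->
  (forall x, A x -> exists2 N, nbhs x N & P (A `&` N)) ->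
  compact A -> P A.
Proof.
move=> P0 PS PU PN cA; apply: contrapT => nPA.
pose F : set_system T := [set S | P (A `\` S)].
have FF : ProperFilter F.
  split; first by rewrite /F /= setD0.
  split; first by rewrite /F /= setDT.
  - move=> S S'; rewrite /F /= => PAS PAS'; apply: PS (PU _ _ PAS PAS').
    by rewrite setDIr.
  - by move=> S S' SS'; apply: PS => x [Ax S'x]; split=> // /SS'.
have [|x [Ax clx]] := cA F FF; first by rewrite /F /= setDv.
have [N Nx PAN] := PN _ Ax.
have [|y []//] := clx (~` N) N _ Nx.
by rewrite /F /= setDE setCK.
Qed.

(** The place where effectiveness enters: after shrinking V, the arrows of U
    from V to V are either exactly the points of V, or there are none.
    If U meets W inside V, intersect V with U: an arrow of U whose source lies
    in U equals this source. Otherwise the points of U may be removed from V,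
    and if then no arrow of U has its source in both V and W, so may the sources
    of U. In the remaining case the arrows of U that start in V and lie over W
    form a nonempty relatively open set without units, so by effectiveness one
    of them has distinct range and source, which the Hausdorff property
    separates. *)
Lemma effective_shrink (S W U V : set G) :
  (forall g, S g -> W (gs g) -> W (gr g)) -> effective (reduction S W) ->
  compact_open_bisection U -> U `<=` S ->
  compact_open_bisection V -> V `&` W !=set0 ->
  exists V', [/\ compact_open_bisection V', V' `<=` V, V' `&` W !=set0 &
    (V' `<=` U /\ forall g, U g -> V' (gs g) -> g = gs g) \/
    (forall g, U g -> V' (gr g) -> V' (gs g) -> False)].
Proof.
move=> Winv eff cU US cV [v [Vv Wv]].
have [oU sU] : open U /\ {in U &, injective (@gs G)} by case: cU => _ ? [].
have [[w [[Vw Ww] Uw]]|nUVW] := pselect (V `&` W `&` U !=set0).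
  exists (V `&` U); split; first by apply: cobI => //; exact: cob_closed.
  - exact: subIsetl.
  - by exists w.
  left; split; first exact: subIsetr.
  move=> g Ug [Vg Ugs]; apply: sU; rewrite ?inE //.
  by rewrite [RHS]gs_gunit // gr_gs.
have cVU := cobD cV cU.
have VUW x : V x -> W x -> (V `\` U) x.
  by move=> Vx Wx; split=> // Ux; apply: nUVW; exists x.
have [[g [Ug VUs Ws]]|nU] :=
    pselect (exists g, [/\ U g, (V `\` U) (gs g) & W (gs g)]); last first.
  exists ((V `\` U) `\` (@gs G @` U)); split.
  - by apply: cobD => //; exact: cob_gs.
  - by move=> x [[]].
  - exists v; split=> //; split; first exact: VUW.
    move=> [g Ug gv]; apply: nU; exists g; rewrite gv; split=> //.
    exact: VUW.
  - by right=> g Ug _ [_]; apply; exists g.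
pose O := U `&` @gs G @^-1` (V `\` U).
have oO : open O.
  apply: openI => //; apply: open_comp; last by case: cVU.
  by move=> x _; exact: gs_continuous.
have [k [Ok Wk rsk]] : exists k, [/\ O k, W (gs k) & gr k <> gs k].
  apply: contrapT => nk.
  have Tg : reduction S W g.
    by split; [exact: US|split=> //; apply: Winv => //; exact: US].
  have : (reduction S W `&` @gunit G) g.
    rewrite -eff.
    have oT : open (O `&` reduction S W : set (subspace (reduction S W))).
      by rewrite open_subspaceIT; exact: open_subspaceW.
    have sub : O `&` reduction S W `<=` isotropy (reduction S W).
      move=> x [Ox Tx]; split=> //=; apply: contrapT => rsx.
      by apply: nk; exists x; case: Tx => _ [].
    move: sub; rewrite (open_subsetE _ oT) => sub.
    by apply: sub; split => //; split.
  by move=> [_ /gs_gunit gg]; case: VUs => _; rewrite gg.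
have [Q [P [oQ oP Qk Pk QP]]] := hausdorff_separation rsk.
have oX : open (P `&` (@gs G @` (O `&` @gr G @^-1` Q))).
  apply: openI => //; apply: gs_open; apply: openI => //.
  apply: open_comp => //.
  by move=> x _; exact: gr_continuous.
have [|V' [cV' V'k V'sub]] := @cob_nbhs (gs k)
    (P `&` (@gs G @` (O `&` @gr G @^-1` Q))).
  by apply: open_nbhs_nbhs; split=> //; split=> //; exists k.
exists V'; split => //.
- by move=> x /V'sub [_ [y [[_ [Vy _]] _] <-]].
- by exists (gs k).
right=> x Ux V'r /V'sub [_ [y [[Uy _] Qy] xy]].
have {}xy : y = x by apply: sU; rewrite ?inE.
by apply: (QP (gr x)); [rewrite -xy|case: (V'sub _ V'r)].
Qed.

End Topology.

(** * Convolution with the indicator of a bisection *)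

Section Convolution.
Variables (G : topologicalGroupoidType) (K : fieldType).
Implicit Types (U V : set G) (f g : G -> K^o).

Lemma convolution_neq0 f g x : convolution K f g x <> 0 ->
  exists a b, [/\ gs a = gr b, gmul a b = x, f a <> 0 & g b <> 0].
Proof.
move=> fgx; apply: contrapT => nab; apply: fgx.
rewrite /convolution fsbig1 // => -[a b] /= [ab abx].
have [->|/eqP fa] := eqVneq (f a) 0; first by rewrite mul0r.
have [->|/eqP gb] := eqVneq (g b) 0; first by rewrite mulr0.
by case: nab; exists a, b.
Qed.

(** Convolving with the indicator of a bisection translates functions: in the
    defining sum only the factorization through b can contribute. *)
Lemma convolution_indicl U f b y : bisection U -> U b -> gs b = gr y ->
  convolution K \1_U f (gmul b y) = f y.
Proof.
move=> [rU _] Ub bry; rewrite /convolution.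
rewrite -(fsbig_widen [set (b, y)]) ?fsbig_set1 /= ?indicE ?mem_set ?mul1r //.
  by move=> _ ->.
move=> [b' y'] [/= [bry' e] neq]; rewrite indicE.
have [Ub'|nUb'] := pselect (U b'); last by rewrite memNset // mul0r.
have bb' : b' = b by apply: rU; rewrite ?inE // -(gr_gmul _ _ bry') e gr_gmul.
case: neq; rewrite bb' in bry' e *; congr pair.
exact: gmulI e.
Qed.

Lemma convolution_indicr U f b y : bisection U -> U b -> gs y = gr b ->
  convolution K f \1_U (gmul y b) = f y.
Proof.
move=> [_ sU] Ub bry; rewrite /convolution.
rewrite -(fsbig_widen [set (y, b)]) ?fsbig_set1 /= ?indicE ?mem_set ?mulr1 //.
  by move=> _ ->.
move=> [y' b'] [/= [bry' e] neq]; rewrite indicE.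
have [Ub'|nUb'] := pselect (U b'); last by rewrite memNset // mulr0.
have bb' : b' = b by apply: sU; rewrite ?inE // -(gs_gmul _ _ bry') e gs_gmul.
case: neq; rewrite bb' in bry' e *; congr pair.
exact: gmulIg e.
Qed.

Lemma convolution_gunitl V f x : V `<=` @gunit G ->
  convolution K \1_V f x = \1_V (gr x) * f x.
Proof.
move=> V1; rewrite indicE; have [Vx|nVx] := pselect (V (gr x)).
  rewrite mem_set // mul1r -{1}[x]gmul_gr convolution_indicl ?gs_gr //.
  exact: bisection_gunit.
rewrite memNset // mul0r; apply: contrapT => /convolution_neq0.
move=> [a [b [ab abx Va _]]]; apply: Va; rewrite indicE memNset // => Va.
by apply: nVx; rewrite -abx gr_gmul // (V1 _ Va).
Qed.

Lemma convolution_gunitr V f x : V `<=` @gunit G ->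
  convolution K f \1_V x = f x * \1_V (gs x).
Proof.
move=> V1; rewrite indicE; have [Vx|nVx] := pselect (V (gs x)).
  rewrite mem_set // mulr1 -{1}[x]gmul_gs convolution_indicr ?gr_gs //.
  exact: bisection_gunit.
rewrite memNset // mulr0; apply: contrapT => /convolution_neq0.
move=> [a [b [ab abx _ Vb]]]; apply: Vb; rewrite indicE memNset // => Vb.
by apply: nVx; rewrite -abx gs_gmul // gs_gunit //; exact: V1.
Qed.

Lemma bisection_setgmul U V :
  bisection U -> bisection V -> bisection (setgmul U V).
Proof.
move=> [rU sU] [rV sV]; split=> x y; rewrite !inE.
  move=> [a [b [Ua Vb ab ->]]] [a' [b' [Ua' Vb' ab' ->]]].
  rewrite !gr_gmul // => raa'.
  have aa' : a = a' by apply: rU; rewrite ?inE.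
  rewrite -aa' in ab' *; congr gmul.
  by apply: rV; rewrite ?inE // -ab -ab'.
move=> [a [b [Ua Vb ab ->]]] [a' [b' [Ua' Vb' ab' ->]]].
rewrite !gs_gmul // => sbb'.
have bb' : b = b' by apply: sV; rewrite ?inE.
rewrite -bb' in ab' *; congr gmul.
by apply: sU; rewrite ?inE // ab ab'.
Qed.

End Convolution.

(** * Functions in the Steinberg algebra *)

Section Steinberg.
Variables (G : topologicalGroupoidType) (K : fieldType).
Hypothesis ampleG : ample_hausdorff G.
Implicit Types (U V : set G) (f g : G -> K^o).

Let A := steinberg G K.

Lemma steinberg_indic U : compact_open_bisection U -> A \1_U.
Proof. by move=> cU; apply: sub_lspan; exists U. Qed.

Lemma steinberg_locally_constant f x : A f -> \forall y \near x, f y = f x.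
Proof.
pose V := [set f : G -> K^o | \forall y \near x, f y = f x].
apply: (@lspan_min _ _ _ V).
  split; first by apply: nearW.
  move=> k g h gx hx; near=> y; rewrite /=.
  rewrite !fctE.
  have -> : g y = g x by near: y.
  by have -> : h y = h x by near: y.
move=> _ [U cU ->]; rewrite /V /=; have [Ux|nUx] := pselect (U x).
  have : nbhs x U by case: cU => _ oU _; exact: open_nbhs_nbhs.
  by apply: filterS => y Uy; rewrite !indicE !mem_set.
have : nbhs x (~` U).
  by apply: open_nbhs_nbhs; split=> //; rewrite openC; exact: cob_closed.
by apply: filterS => y Uy; rewrite !indicE !memNset.
Unshelve. all: by end_near. Qed.

Lemma steinberg_compact_support f : A f ->
  exists2 C : set G, compact C & forall x, f x <> 0 -> C x.
Proof.
pose V := [set f : G -> K^o |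
  exists2 C : set G, compact C & forall x, f x <> 0 -> C x].
apply: (@lspan_min _ _ _ V).
  split; first by exists set0 => //; exact: compact0.
  move=> k g h [C cC gC] [D cD hD]; exists (C `|` D); first exact: compactU.
  move=> x; rewrite fctE.
  have [gx0|/eqP/gC] := eqVneq (g x) 0; last by left.
  have [hx0|/eqP/hD] := eqVneq (h x) 0; last by right.
  by case; rewrite -[_ + _]/(k * g x + h x) gx0 hx0 mulr0 addr0.
move=> _ [U [cU oU bU] ->]; exists U => // x; rewrite indicE.
by apply: contra_notP => nUx; rewrite memNset.
Qed.

(** Functions of the Steinberg algebra are locally constant with compact
    support, and this forces the set carrying an indicator to be clopen and
    compact. *)
Lemma cob_of_steinberg_indic U : bisection U -> A \1_U ->
  compact_open_bisection U.
Proof.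
move=> bU AU; have [C cC UC] := steinberg_compact_support AU.
have lc x := steinberg_locally_constant x AU.
have oU : open U.
  rewrite openE => x Ux; apply: filterS (lc x) => y.
  rewrite !indicE (mem_set Ux) => /eqP; case: (pselect (U y)) => // nUy.
  by rewrite memNset // eq_sym oner_eq0.
split=> //; apply: subclosed_compact cC _.
  rewrite -openC openE => x nUx; apply: filterS (lc x) => y.
  rewrite !indicE (memNset nUx) => /eqP; case: (pselect (U y)) => // Uy.
  by rewrite mem_set // oner_eq0.
by move=> x Ux; apply: UC; rewrite indicE mem_set //; apply/eqP/oner_neq0.
Qed.

(** Restriction to a clopen set Z sends the indicator of U to the indicator of
    the intersection of U and Z, hence preserves spans of indicators. In
    particular, functions of A supported in a fibre of c are homogeneous. *)
Lemma steinberg_supported f (Z : set G) : open Z -> closed Z -> A f ->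
  (forall x, f x <> 0 -> Z x) ->
  lspan [set g : G -> K^o | exists2 U,
    compact_open_bisection U /\ U `<=` Z & g = \1_U] f.
Proof.
move=> oZ cZ Af fZ; set L := lspan _.
pose V := [set f : G -> K^o | L (fun x => \1_Z x * f x)].
have sL : subspace_closed L by exact: lspan_subspace.
have : V f.
  apply: (@lspan_min _ _ _ V) Af.
    split; rewrite /V /=.
      have -> : (fun x => \1_Z x * (0 : G -> K^o) x) = 0 :> (G -> K^o).
        by apply/funext => x; rewrite mulr0.
      by case: sL.
    move=> k g h Vg Vh.
    have -> : (fun x => \1_Z x * (k *: g + h) x) =
        k *: (fun x => \1_Z x * g x) + (fun x => \1_Z x * h x) :> (G -> K^o).
      apply/funext => x; rewrite !fctE mulrDr; congr (_ + _).
      by rewrite -[k *: g x]/(k * g x) mulrCA.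
    by case: sL => _; apply.
  move=> _ [U cU ->]; rewrite /V /=.
  have -> : (fun x => \1_Z x * \1_U x) = \1_(U `&` Z) :> (G -> K^o).
    by apply/funext => x; rewrite indicI mulrC.
  apply: sub_lspan; exists (U `&` Z) => //; split; first exact: cobI.
  exact: subIsetr.
rewrite /V /=; congr (L _); apply/funext => x; rewrite indicE.
have [/fZ Zx|] := pselect (f x <> 0); first by rewrite mem_set ?mul1r.
by move=> /contrapT ->; rewrite mulr0.
Qed.

(** Cutting down by a suitable V' turns f into a multiple of the indicator of
    V'. The functions with this property for all V form a subspace, because V'
    may be shrunk further for each summand; it is enough to treat indicators,
    which is the dichotomy of [effective_shrink]. *)
Lemma steinberg_effective_cutdown (S W V : set G) f :
  (forall x, S x -> W (gs x) -> W (gr x)) -> effective (reduction S W) ->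
  lspan [set g : G -> K^o | exists2 U,
    compact_open_bisection U /\ U `<=` S & g = \1_U] f ->
  compact_open_bisection V -> V `<=` @gunit G -> V `&` W !=set0 ->
  exists V', [/\ compact_open_bisection V', V' `<=` V, V' `&` W !=set0 &
    exists b : K, forall x, V' (gr x) -> V' (gs x) -> f x = b * \1_V' x].
Proof.
move=> Winv eff Sf cV V1 VW.
pose Q := [set f : G -> K^o | forall V,
  compact_open_bisection V -> V `<=` @gunit G -> V `&` W !=set0 ->
  exists V', [/\ compact_open_bisection V', V' `<=` V, V' `&` W !=set0 &
    exists b : K, forall x, V' (gr x) -> V' (gs x) -> f x = b * \1_V' x]].
suff : Q f by apply.
apply: (@lspan_min _ _ _ Q) Sf => {f cV V1 VW}.
  split=> [{}V cV V1 VW|k g h Qg Qh {}V cV V1 VW].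
    by exists V; split=> //; exists 0 => x _ _; rewrite mul0r.
  have [V' [cV' V'V V'W [b gb]]] := Qg V cV V1 VW.
  have V'1 := subset_trans V'V V1.
  have [V'' [cV'' V''V' V''W [d hd]]] := Qh V' cV' V'1 V'W.
  exists V''; split=> //; first exact: subset_trans V'V.
  exists (k * b + d) => x rx sx.
  have e : \1_V' x = \1_V'' x :> K.
    rewrite !indicE; congr (nat_of_bool _)%:R; apply/idP/idP; rewrite !inE.
      by move=> /V'1 xx; rewrite -xx.
    exact: V''V'.
  rewrite !fctE hd // gb; [|exact: V''V'..].
  by rewrite e -[_ *: _]/(k * _) mulrDl mulrA.
move=> _ [U [cU US] ->] {}V cV V1 VW.
have [V' [cV' V'V V'W V'U]] := effective_shrink ampleG Winv eff cU US cV VW.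
exists V'; split=> //; case: V'U => [[V'U Us]|V'U].
  exists 1 => x rx sx; rewrite mul1r !indicE; congr (nat_of_bool _)%:R.
  apply/idP/idP; rewrite !inE; last exact: V'U.
  by move=> /Us ->.
exists 0 => x rx sx; rewrite mul0r indicE memNset // => Ux.
exact: V'U Ux rx sx.
Qed.

End Steinberg.

(** * Ideals and the sources of their indicators *)

Section Ideals.
Variables (G : topologicalGroupoidType) (K : fieldType).
Hypothesis ampleG : ample_hausdorff G.
Variable J : set (G -> K^o).
Hypothesis idJ : is_ideal (convolution K) (steinberg G K) J.

Let sJ : subspace_closed J. Proof. by case: idJ. Qed.

Let JA : J `<=` steinberg G K. Proof. by case: idJ. Qed.

(** The units at which J is visible through the indicator of a bisection.
    Sources of arbitrary bisections are taken, instead of units contained in a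
    compact open set of units with indicator in J, so that invariance follows
    from one multiplication on the right. *)
Definition ideal_sources : set G :=
  [set x | exists U, [/\ compact_open_bisection U, J \1_U & (@gs G @` U) x]].

Lemma ideal_mulr_indic (f : G -> K^o) (U : set G) :
  compact_open_bisection U -> J f -> J (convolution K f \1_U).
Proof.
move=> cU Jf; case: idJ => _ _ /(_ \1_U f) [] //.
exact: steinberg_indic.
Qed.

Lemma ideal_mull_indic (f : G -> K^o) (U : set G) :
  compact_open_bisection U -> J f -> J (convolution K \1_U f).
Proof.
move=> cU Jf; case: idJ => _ _ /(_ \1_U f) [] //.
exact: steinberg_indic.
Qed.

(** The indicator of the product lies in J, hence in A, so that the product is
    compact and open. *)
Lemma ideal_setgmulr (U V : set G) :
  compact_open_bisection U -> compact_open_bisection V -> J \1_U ->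
  compact_open_bisection (setgmul U V) /\ J \1_(setgmul U V).
Proof.
move=> cU cV JU.
have [[_ _ bU] [_ _ bV]] := (cU, cV).
have JUV : J \1_(setgmul U V).
  by rewrite -convolution_indic //; exact: ideal_mulr_indic.
split=> //; apply: (@cob_of_steinberg_indic _ K ampleG) (JA JUV).
exact: bisection_setgmul.
Qed.

Lemma ideal_setgmull (U V : set G) :
  compact_open_bisection U -> compact_open_bisection V -> J \1_V ->
  compact_open_bisection (setgmul U V) /\ J \1_(setgmul U V).
Proof.
move=> cU cV JV.
have [[_ _ bU] [_ _ bV]] := (cU, cV).
have JUV : J \1_(setgmul U V).
  by rewrite -convolution_indic //; exact: ideal_mull_indic.
split=> //; apply: (@cob_of_steinberg_indic _ K ampleG) (JA JUV).
exact: bisection_setgmul.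
Qed.

Lemma open_ideal_sources : open ideal_sources.
Proof.
rewrite openE => x [U [cU JU Ux]].
have : nbhs x (@gs G @` U).
  by apply: open_nbhs_nbhs; split=> //; apply: gs_open => //; case: cU.
by apply: filterS => y Uy; exists U.
Qed.

Lemma ideal_sources_invariant g :
  ideal_sources (gs g) -> ideal_sources (gr g).
Proof.
move=> [U [cU JU [y Uy yg]]].
have [V [cV Vg _]] := cob_nbhs ampleG (@filterT _ (nbhs (ginv g)) _).
have [cUV JUV] := ideal_setgmulr cU cV JU.
exists (setgmul U V); split=> //; exists (gmul y (ginv g)).
  by exists y, (ginv g); rewrite gr_ginv.
by rewrite gs_gmul ?gs_ginv // gr_ginv.
Qed.

Definition sourceless_units : set G := @gunit G `\` ideal_sources.

Lemma closed_sourceless_units : closed sourceless_units.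
Proof.
rewrite /sourceless_units setDE; apply: closedI; first exact: closed_gunit.
by rewrite closedC; exact: open_ideal_sources.
Qed.

Lemma sourceless_units_invariant g :
  sourceless_units (gs g) <-> sourceless_units (gr g).
Proof.
have imp x : sourceless_units (gs x) -> sourceless_units (gr x).
  move=> [_ nD]; split; first exact/gr_gunit_gs/gs_gr.
  move=> Dr; apply: nD; rewrite -gr_ginv; apply: ideal_sources_invariant => //.
  by rewrite gs_ginv.
by split=> [/imp //|Wr]; rewrite -gr_ginv; apply: imp; rewrite gs_ginv.
Qed.

(** By compactness, an indicator 1_C lies in J as soon as C is covered by
    bisections N contained in C with 1_N in J. Around x in C, translate a
    bisection U with 1_U in J and with an arrow y having the same source as x:
    multiplying on the left by a bisection V around x y^-1 gives a bisection VU
    through x with indicator in J. Cutting down VU to the sources of a small N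
    leaves N. *)
Lemma ideal_sources_full : @gunit G `<=` ideal_sources -> J = steinberg G K.
Proof.
move=> D1; rewrite eqEsubset; split=> //.
apply: lspan_min => // _ [C cC ->].
have [_ _ bC] := cC.
pose P := [set S : set G | exists C', [/\ compact_open_bisection C', S `<=` C',
  C' `<=` C & J \1_C']].
(* S is only required to lie in C', so that P is hereditary. *)
suff [C' [_ CC' C'C JC']] : P C.
  by have -> : C = C' by rewrite eqEsubset.
have cutr (X Y : set G) :
    compact_open_bisection X -> compact_open_bisection Y ->
    X `<=` C -> Y `<=` C -> J \1_X -> J \1_(X `&` Y).
  move=> cX cY XC YC JX.
  have -> : \1_(X `&` Y) = convolution K \1_X \1_(@gs G @` Y) :> (G -> K^o).
    apply/funext => x; rewrite convolution_gunitr; last exact: gs_sub_gunit.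
    rewrite !indicE in_setI; have [Xx|nXx] := pselect (X x); last first.
      by rewrite memNset // mul0r.
    rewrite mem_set // mul1r /=.
    congr (nat_of_bool _)%:R; apply/idP/idP; rewrite !inE.
      by move=> Yx; exists x.
    move=> [y Yy yx]; case: bC => _ sC.
    suff -> : x = y by [].
    by apply: sC; rewrite ?inE //; [exact: XC|exact: YC].
  by apply: ideal_mulr_indic JX; exact: cob_gs.
apply: compact_ind; last by case: cC.
- exists set0; split=> //; first exact: cob0.
  have -> : \1_set0 = 0 :> (G -> K^o).
    by apply/funext => x; rewrite indicE memNset.
  by case: sJ.
- move=> S S' SS' [C' [cC' S'C' C'C JC']]; exists C'; split=> //.
  exact: subset_trans SS' S'C'.
- move=> S S' [X [cX SX XC JX]] [Y [cY SY YC JY]].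
  have XYC : X `|` Y `<=` C by move=> x [/XC|/YC].
  exists (X `|` Y); split=> //.
  + exact: cobU bC XYC.
  + exact: setUSS.
  have -> : \1_(X `|` Y) = \1_X + \1_Y - \1_(X `&` Y) :> (G -> K^o).
    apply/funext => x; rewrite !fctE !indicE in_setU in_setI.
    by case: (x \in X); case: (x \in Y);
      rewrite /= ?mulr0n ?mulr1n ?add0r ?addrK ?oppr0 ?addr0.
  apply: (subspaceB sJ); last exact: cutr.
  exact: (subspaceD sJ).
move=> x Cx.
have [|U [cU JU [y Uy yx]]] := D1 (gs x); first exact: gr_gs.
have [V [cV Vxy _]] := cob_nbhs ampleG
  (@filterT _ (nbhs (gmul x (ginv y))) _).
have [cVU JVU] := ideal_setgmull cV cU JU.
have [oVU bVU] : open (setgmul V U) /\ bisection (setgmul V U) by case: cVU.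
have VUx : setgmul V U x.
  exists (gmul x (ginv y)), y; rewrite gs_gmul ?gr_ginv // gs_ginv; split=> //.
  by rewrite -gmulA ?gr_ginv ?gs_ginv // gmulVg yx gmul_gs.
have [N [cN Nx NVUC]] : exists N, [/\ compact_open_bisection N, N x &
    N `<=` setgmul V U `&` C].
  apply: cob_nbhs => //; apply: open_nbhs_nbhs; split=> //.
  by apply: openI => //; case: cC.
exists N; first by case: cN => _ oN _; exact: open_nbhs_nbhs.
exists N; split=> //.
  by move=> z /NVUC [].
have -> : \1_N = convolution K \1_(setgmul V U) \1_(@gs G @` N) :> (G -> K^o).
  apply/funext => z; rewrite convolution_gunitr; last exact: gs_sub_gunit.
  rewrite !indicE.
  have [Nz|nNz] := pselect (N z).
    have [VUz _] := NVUC _ Nz.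
    have sNz : (@gs G @` N) (gs z) by exists z.
    by rewrite (mem_set Nz) (mem_set VUz) (mem_set sNz) mulr1.
  rewrite memNset //; have [VUz|nVUz] := pselect (setgmul V U z); last first.
    by rewrite memNset // mul0r.
  rewrite [gs z \in _]memNset ?mulr0 // => -[t Nt tz]; apply: nNz.
  suff <- : t = z by [].
  by case: bVU => _; apply; rewrite ?inE //; case: (NVUC _ Nt).
by apply: ideal_mulr_indic JVU; exact: cob_gs.
Qed.

End Ideals.

(** * Homogeneous components *)

Section Grading.
Variables (G : topologicalGroupoidType) (K : fieldType).
Variables (H : groupType) (c : G -> H).
Hypothesis ampleG : ample_hausdorff G.
Hypothesis cocycle_c : continuous_cocycle c.
Implicit Types (f : G -> K^o) (J : set (G -> K^o)).

Let A := steinberg G K.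
Let Ah := steinberg_component K c.

Lemma open_cocycle_fiber h : open (c @^-1` [set h]).
Proof.
case: cocycle_c => _ cc.
apply: (@open_comp _ (discrete_topology H)); last exact: discrete_open.
by move=> x _; exact: cc.
Qed.

Lemma closed_cocycle_fiber h : closed (c @^-1` [set h]).
Proof.
rewrite -openC openE => x /= cx.
have : nbhs x (c @^-1` [set c x]).
  by apply: open_nbhs_nbhs; split=> //; exact: open_cocycle_fiber.
by apply: filterS => y /= ->.
Qed.

Lemma cocycle_gunit u : gr u = u -> c u = 1%g.
Proof.
move=> uu; case: cocycle_c => cM _.
have uuu : gmul u u = u by rewrite -{1}uu gmul_gr.
have cu : c u = (c u * c u)%g by rewrite -cM ?uuu // gs_gunit // uu.
by apply: (mulgI (c u)); rewrite mulg1 -cu.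
Qed.

Lemma component_supported h f : Ah h f -> forall x, f x <> 0 -> c x = h.
Proof.
pose V := [set f : G -> K^o | forall x, f x <> 0 -> c x = h].
apply: (@lspan_min _ _ _ V).
  split=> // k g g' Vg Vg' x; rewrite fctE -[_ + _]/(k * g x + g' x).
  have [gx0|/eqP/Vg //] := eqVneq (g x) 0.
  have [hx0|/eqP/Vg' //] := eqVneq (g' x) 0.
  by rewrite gx0 hx0 mulr0 addr0.
move=> _ [U [_ Uh] ->] x; rewrite indicE.
have [/Uh //|nUx] := pselect (U x).
by rewrite memNset.
Qed.

(** The fibres of c are disjoint, so at each arrow only the component of its
    degree contributes. This gives uniqueness of homogeneous decompositions. *)
Lemma graded_sum_eval (w : H -> G -> K^o) x :
  (forall h y, w h y <> 0 -> c y = h) -> finite_set [set h | w h <> 0] ->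
  (\sum_(h \in [set: H]) w h) x = w (c x) x.
Proof.
move=> wc fw.
rewrite -(fsbig_widen [set h | w h <> 0] setT) //; last first.
  by move=> h [_ /= /contrapT].
rewrite fsbig_finite // fct_sumE.
have w0 h : h != c x -> w h x = 0.
  by move=> hx; apply: contrapT => /wc e; rewrite e eqxx in hx.
have [wx|/contrapT wx] := pselect (w (c x) <> 0).
  rewrite (bigD1_seq (c x)) ?fset_uniq //=; last first.
    by rewrite in_fset_set // inE.
  by rewrite big1 ?addr0.
rewrite big1_seq ?wx // => h /= hw; apply: w0.
apply/eqP => hx; move: hw; rewrite in_fset_set // inE /= hx.
exact.
Qed.

Lemma graded_ideal_homogeneous J f x :
  graded_ideal (convolution K) A Ah J -> J f -> f x <> 0 ->
  exists f', [/\ J f', f' x <> 0 & forall y, f' y <> 0 -> c y = c x].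
Proof.
move=> [_ [_ /(_ f) dec]] /dec [w [[wJ fw fE] _]] fx.
have wc h y : w h y <> 0 -> c y = h.
  by case: (wJ h) => /component_supported + _ => /[apply].
exists (w (c x)); split; first by case: (wJ (c x)).
  by move: fx; rewrite fE graded_sum_eval.
by move=> y; exact: wc.
Qed.

(** Let W be the set of units that are not in [ideal_sources J]. If f in J were
    nonzero at an arrow with source in W, one could produce a compact open set V
    of units that meets W and has its indicator in J, contrary to the definition
    of W. Gradedness allows f to be homogeneous, and translation allows its
    degree to be the identity of H, where effectiveness applies. *)
Lemma graded_ideal_vanish J f g :
  strongly_effective (c @^-1` [set 1%g]) ->
  graded_ideal (convolution K) A Ah J -> J f ->
  ~ ideal_sources J (gs g) -> f g = 0.
Proof.
move=> seff grJ Jf nDg; apply: contrapT => fg.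
have [idJ _] := grJ; have [JA sJ _] := idJ.
have [f1 [Jf1 f1g f1c]] := graded_ideal_homogeneous grJ Jf fg.
have [cM _] := cocycle_c.
pose u := gs g; have uu : gr u = u by exact: gr_gs.
pose S := c @^-1` [set 1%g].
have [B [cB Bg Bc]] : exists B, [/\ compact_open_bisection B, B (ginv g) &
    B `<=` c @^-1` [set c (ginv g)]].
  apply: cob_nbhs => //; apply: open_nbhs_nbhs; split=> //.
  exact: open_cocycle_fiber.
(* The translate of f1 to the identity degree; its value at u is f1 g. *)
pose e := convolution K \1_B f1.
have Je : J e by exact: ideal_mull_indic.
have eu : e u = f1 g.
  rewrite /e /u -gmulVg convolution_indicl ?gs_ginv //.
  by case: cB.
have eS x : e x <> 0 -> S x.
  move=> /convolution_neq0 [a [b [ab <- Ba fb]]]; rewrite /S /=.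
  have Ba' : B a.
    by move: Ba; rewrite indicE; apply: contra_notP => ?; rewrite memNset.
  rewrite cM // (Bc _ Ba') (f1c _ fb) -cM ?gs_ginv // gmulVg.
  exact: cocycle_gunit.
have oS : open S by exact: open_cocycle_fiber.
have cS : closed S by exact: closed_cocycle_fiber.
have eL := steinberg_supported oS cS (JA _ Je) eS.
pose W := sourceless_units J.
have Winv x : W (gs x) -> W (gr x).
  by case: (sourceless_units_invariant ampleG idJ x).
have W1 : W `<=` S `&` @gunit G.
  by move=> x [xx _]; split=> //; exact: cocycle_gunit.
have effW : effective (reduction S W).
  apply: seff.
    split=> //; rewrite eqEsubset; split=> [_ [x [_ /= Wx] <-]|x Wx].
      exact: Winv.
    have [Sx xx] := W1 _ Wx.
    by exists x => //; split=> //=; rewrite gs_gunit.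
  by apply: closed_subspaceW; exact: closed_sourceless_units.
have [V0 [cV0 V0u V0sub]] : exists V, [/\ compact_open_bisection V, V u &
    V `<=` [set y | e y = e u] `&` @gunit G].
  apply: cob_nbhs => //; apply: filterI.
    exact: steinberg_locally_constant (JA _ Je).
  by apply: open_nbhs_nbhs; split=> //; exact: open_gunit.
have V01 : V0 `<=` @gunit G by move=> x /V0sub [].
have V0W : V0 `&` W !=set0 by exists u.
have [V [cV VV0 [v [Vv [vv nDv]]] [b eb]]] := steinberg_effective_cutdown
  ampleG (fun x _ => @Winv x) effW eL cV0 V01 V0W.
have V1 := subset_trans VV0 V01.
(* Compare the values at v, where e is nonzero because e v = e u. *)
have b0 : b != 0.
  have [ev _] := V0sub _ (VV0 _ Vv).
  apply/eqP => b0; apply: f1g; rewrite -eu -ev eb ?b0 ?mul0r //.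
    by rewrite vv.
  by rewrite gs_gunit.
apply: nDv; exists V; split=> //; last by exists v => //; exact: gs_gunit.
have -> : \1_V = b^-1 *: convolution K (convolution K \1_V e) \1_V
    :> (G -> K^o).
  apply/funext => x; rewrite fctE convolution_gunitr // convolution_gunitl //.
  rewrite -[RHS]/(b^-1 * (\1_V (gr x) * e x * \1_V (gs x))) !indicE.
  have [Vrx|nVrx] := pselect (V (gr x)); last first.
    rewrite [gr x \in _]memNset // !mul0r mulr0 memNset // => Vx.
    by apply: nVrx; rewrite (V1 _ Vx).
  have [Vsx|nVsx] := pselect (V (gs x)); last first.
    rewrite [gs x \in _]memNset // !mulr0 memNset // => Vx.
    by apply: nVsx; rewrite gs_gunit //; exact: V1.
  by rewrite (mem_set Vrx) (mem_set Vsx) mul1r mulr1 eb // indicE mulKf.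
apply: subspaceZ => //; apply: ideal_mulr_indic => //.
exact: ideal_mull_indic.
Qed.

End Grading.

(** * Functions supported on finitely many arrows *)

Lemma finite_supported_sum (T : choiceType) (K : fieldType) (R : set T)
    (f : T -> K^o) : finite_set R -> (forall x, f x <> 0 -> R x) ->
  f = \sum_(t <- fset_set R) f t *: (\1_[set t] : T -> K^o).
Proof.
move=> finR fR; apply/funext => x; rewrite fct_sumE.
have tx (t : T) : t != x -> (f t *: (\1_[set t] : T -> K^o)) x = 0.
  move=> /eqP tx; rewrite fctE indicE memNset ?scaler0 //= => xt.
  exact: tx.
have [fx|/contrapT fx] := pselect (f x <> 0).
  rewrite (bigD1_seq x) ?fset_uniq //=; last first.
    by rewrite in_fset_set // inE; exact: fR.
  rewrite big1 ?addr0 //.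
  by rewrite fctE indicE mem_set // -[LHS]mulr1.
rewrite fx big1 // => t _; have [->|/tx //] := eqVneq t x.
by rewrite fctE fx scale0r.
Qed.

Section FiniteReduction.
Variables (G : topologicalGroupoidType) (K : fieldType).
Hypothesis ampleG : ample_hausdorff G.

Lemma cob_set1 (R : set G) x : finite_set R -> open R -> R x ->
  compact_open_bisection [set x].
Proof.
move=> finR oR Rx; split; first exact: compact_set1.
  have -> : [set x] = R `&` ~` (R `\ x).
    rewrite eqEsubset; split=> [_ ->|y [Ry nRy]].
      by split=> // -[_ /(_ erefl)].
    by apply: contrapT => yx; apply: nRy.
  apply: openI => //; rewrite openC.
  have [_ hausG _ _] := ampleG.
  have /accessible_finite_set_closed := hausdorff_accessible hausG; apply.
  exact: finite_setD.
by split=> y z; rewrite !inE => -> ->.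
Qed.

(** In a Hausdorff space the points of a finite open set are open, so every
    function supported on the arrows over W lies in the Steinberg algebra, and
    so do its restrictions to the fibres of c. Following supports, invariance of
    W makes these functions a two-sided ideal. *)
Lemma finite_support_ideal (H : groupType) (c : G -> H) (W : set G) :
  continuous_cocycle c -> (forall g, W (gs g) <-> W (gr g)) ->
  finite_set (@gs G @^-1` W) -> open (@gs G @^-1` W) ->
  graded_ideal (convolution K) (steinberg G K) (steinberg_component K c)
    [set f | forall x, f x <> 0 -> W (gs x)].
Proof.
move=> cocycle_c Winv finR oR; set J := [set f | _].
have JA : J `<=` steinberg G K.
  move=> f Jf; rewrite (finite_supported_sum finR Jf) big_seq.
  apply: subspace_sum; first exact: lspan_subspace.
  move=> t; rewrite in_fset_set // inE => Rt.
  apply: subspaceZ; first exact: lspan_subspace.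
  by apply: steinberg_indic; exact: cob_set1 finR oR Rt.
split; split=> //.
- split=> // k f g Jf Jg x; rewrite fctE -[_ + _]/(k * f x + g x).
  have [fx0|/eqP/Jf //] := eqVneq (f x) 0.
  have [gx0|/eqP/Jg //] := eqVneq (g x) 0.
  by rewrite fx0 gx0 mulr0 addr0.
- move=> a f _ Jf; split=> x /convolution_neq0 [y [z [yz <-]]].
    by move=> _ /Jf; rewrite gs_gmul.
  by move=> /Jf + _; rewrite gs_gmul // yz => /Winv.
move=> f Jf.
pose w h : G -> K^o := fun x => if c x == h then f x else 0.
have wc h x : w h x <> 0 -> c x = h by rewrite /w; case: eqP.
have wJ h : J (w h) by move=> x; rewrite /w; case: ifP => // _ /Jf.
have fw : finite_set [set h | w h <> 0].
  apply: sub_finite_set (finite_image c finR) => h /= wh.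
  apply: contrapT => nh; apply: wh; apply/funext => x.
  by apply: contrapT => wx; apply: nh; exists x; [exact: wJ wx|exact: wc wx].
exists w; split.
  split=> //.
    move=> h; split=> //.
    apply: steinberg_supported; [exact: open_cocycle_fiber|
      exact: closed_cocycle_fiber|exact: JA|exact: wc].
  by apply/funext => x; rewrite (graded_sum_eval x wc fw) /w eqxx.
move=> w' [w'J fw' fE]; apply/funext => h; apply/funext => x.
have w'c k y : w' k y <> 0 -> c y = k.
  by case: (w'J k) => /component_supported + _ => /[apply].
rewrite /w fE (graded_sum_eval x w'c fw'); case: eqP => [<- //|cx].
by apply: esym; apply: contrapT => nz; exact: cx (w'c _ _ nz).
Qed.

(** A is the sum of the span of the atoms 1_x, for the finitely many x in R,
    and of a finite-dimensional complement. *)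
Lemma steinberg_finite_dim (R : set G) : finite_set R -> open R ->
  finite_dim_quotient (steinberg G K)
    [set f : G -> K^o | forall x, f x <> 0 -> R x] ->
  finite_dim (steinberg G K).
Proof.
move=> finR oR [X [finX XA AX]].
pose Y := (fun x => \1_[set x] : G -> K^o) @` R.
exists (X `|` Y); first by rewrite finite_setU; split=> //; exact: finite_image.
rewrite eqEsubset; split=> [f /AX [y Xy Rfy]|].
  have sL := lspan_subspace (X `|` Y).
  rewrite -[f](subrK y); apply: (subspaceD sL); last first.
    by apply: lspanS Xy; exact: subsetUl.
  rewrite (finite_supported_sum finR Rfy) big_seq; apply: subspace_sum => // t.
  rewrite in_fset_set // inE => Rt; apply: subspaceZ => //.
  by apply: sub_lspan; right; exists t.
apply: lspan_min; first exact: lspan_subspace.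
move=> f [/XA //|[x Rx <-]]; apply: steinberg_indic.
exact: cob_set1 finR oR Rx.
Qed.

End FiniteReduction.

(** * Graded just infinite and graded simple Steinberg algebras *)

Theorem theorem5p2 (G : topologicalGroupoidType) (K : fieldType)
    (H : groupType) (c : G -> H)
    (ampleG : ample_hausdorff G)
    (cocycle_c : continuous_cocycle c)
    (seff : strongly_effective (c @^-1` [set 1%g]))
    (fic : FIC G)
    (infdim : ~ finite_dim (steinberg G K)) :
  graded_just_infinite (convolution K) (steinberg G K)
    (steinberg_component K c)
  <->
  graded_simple (convolution K) (steinberg G K)
    (steinberg_component K c).
Proof.
split=> [[_ jinf] J grJ|simple]; last first.
  split=> // J /[dup] grJ /simple [//|->] _.
  exists set0; split=> // x Ax; exists 0; first exact: (lspan_subspace _).1.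
  by rewrite subr0.
have [idJ _] := grJ.
have [|J0] := pselect (J = [set 0]); [by left|right].
have finAJ := jinf J grJ J0.
pose W := sourceless_units J.
have Winv g : W (gs g) <-> W (gr g) by exact: sourceless_units_invariant.
pose R := @gs G @^-1` W.
have finR : finite_set R.
  apply: (finite_set_of_finite_dim_quotient finAJ)
    => [f g Jf [_ nD]|F t finF nFt].
    exact: graded_ideal_vanish grJ Jf nD.
  have [U [cU Ut UF]] : exists U,
      [/\ compact_open_bisection U, U t & U `<=` ~` F].
    apply: cob_nbhs => //; apply: open_nbhs_nbhs; split=> //.
    rewrite openC; have [_ hausG _ _] := ampleG.
    by have /accessible_finite_set_closed := hausdorff_accessible hausG; apply.
  exists \1_U; first exact: steinberg_indic.
  split=> [|x Fx]; rewrite indicE; first by rewrite mem_set.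
  by rewrite memNset // => /UF.
have [W0|nW0] := pselect (W !=set0); last first.
  apply: ideal_sources_full => // x xx.
  by apply: contrapT => nDx; apply: nW0; exists x.
have oW : open W.
  have redR : reduction [set: G] W `<=` R by move=> x [_ []].
  have invW : Defs.invariant [set: G] W.
    split; first by move=> x [xx _].
    rewrite eqEsubset; split=> [_ [x [_ /= Wx] <-]|x Wx]; first exact/Winv.
    by case: (Wx) => xx _; exists x => //; split=> //=; rewrite gs_gunit.
  have [/open_subspaceP [V oV VW] _] :=
    fic _ W0 invW (sub_finite_set redR finR).
  have <- : W `&` @gunit G = W by apply/setIidPl => x [].
  by rewrite -VW; apply: openI => //; exact: open_gunit.
have oR : open R.
  by apply: open_comp => // x _; exact: gs_continuous.
pose JW := [set f : G -> K^o | forall x, f x <> 0 -> W (gs x)].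
have grJW : graded_ideal (convolution K) (steinberg G K)
    (steinberg_component K c) JW by exact: finite_support_ideal.
have [w Ww] := W0.
have Rw : R w by rewrite /R /= gs_gunit //; case: Ww.
have JW0 : JW <> [set 0].
  have JWw : JW \1_[set w].
    move=> y; rewrite indicE; have [->//|nyw] := pselect ([set w] y).
    by rewrite memNset.
  move=> JW0; move: JWw; rewrite JW0 /= => /(congr1 (@^~ w)) /eqP.
  by rewrite indicE mem_set // oner_eq0.
case: infdim; apply: (steinberg_finite_dim ampleG finR oR).
exact: jinf JW grJW JW0.
Qed.
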